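(* Let $n\ge 2$, let $h:[n]\to[n]$ be a Hessenberg function, and let $\mathsf{n}=E_{1n}\in\mathfrak{gl}_n(\mathbb{C})$. The minimal nilpotent matrix Hessenberg scheme $\mathcal{Y}_{\mathsf{n},h}$ is reduced if and only if $h$ is indecomposable.
   Context: Let $[n]=\{1,\dots,n\}$. A Hessenberg function is a map $h:[n]\to[n]$ with $h(i)\le h(i+1)$ for $i<n$ and $h(i)\ge i$ for all $i$; it is indecomposable if $h(i)>i$ for all $i<n$. $E_{ij}$ denotes the matrix unit. Let $\mathbf{z}=\{z_{ij}\mid 1\le i,j\le n\}$, $Z=(z_{ij})$, $d=\det Z$, and let $v_j=\sum_i z_{ij}e_i$ be the $j$-th column of $Z$. For $\mathsf{x}\in \mathfrak{gl}_n(\mathbb{C})$ and each $i$ with $h(i)<n$ let $\mathcal{I}_{\mathsf{x},h,i}\subseteq \mathbb{C}[\mathbf{z}]$ be the ideal generated by all $(h(i)+1)\times(h(i)+1)$ minors of the $n\times(i+h(i))$ matrix $[\mathsf{x}v_1\ \cdots\ \mathsf{x}v_i\ v_1\ \cdots\ v_{h(i)}]$, and $\mathcal{I}_{\mathsf{x},h,i}=0$ if $h(i)=n$. Put $\mathcal{I}_{\mathsf{x},h}=\sum_{i\in[n]}\mathcal{I}_{\mathsf{x},h,i}$ and let $\tilde{\mathcal{I}}_{\mathsf{x},h}=\{f\in \mathbb{C}[\mathbf{z}]\mid d^kf\in\mathcal{I}_{\mathsf{x},h}\text{ for some }k\ge 0\}$. The matrix Hessenberg scheme is $\mathcal{Y}_{\mathsf{x},h}=\operatorname{Spec}\mathbb{C}[\mathbf{z}]/\tilde{\mathcal{I}}_{\mathsf{x},h}$.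 *)

(* Defs.v *)
From HB Require Import structures.
From mathcomp Require Import all_boot all_order all_algebra generic_quotient.
From mathcomp Require Import ring ring_quotient boolp reals complex mpoly.
From mathcomp Require classical_sets.

Set Implicit Arguments.
Unset Strict Implicit.
Unset Printing Implicit Defensive.

Import GRing.Theory.
Local Open Scope ring_scope.
Local Open Scope quotient_scope.

(* The library's [idealr] only covers proper ideals of nontrivial rings; the
   ideals below may be improper, and accordingly their quotients may be
   trivial rings. *)
Record ideal (A : comPzRingType) := Ideal {
  ideal_pred :> {pred A};
  ideal_axiom : [/\ 0 \in ideal_pred,
    forall x y, x \in ideal_pred -> y \in ideal_pred -> x + y \in ideal_pred
    & forall a x, x \in ideal_pred -> a * x \in ideal_pred] }.

Section IdealTheory.
Variables (A : comPzRingType) (I : ideal A).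

Lemma ideal0 : 0 \in I.
Proof. by case: (ideal_axiom I). Qed.

Lemma idealD x y : x \in I -> y \in I -> x + y \in I.
Proof. by case: (ideal_axiom I) => _ + _; apply. Qed.

Lemma idealM a x : x \in I -> a * x \in I.
Proof. by case: (ideal_axiom I) => _ _; apply. Qed.

Lemma ideal_zmod_closed : zmod_closed (ideal_pred I).
Proof.
split; first exact: ideal0.
by move=> x y xI yI; rewrite -mulN1r idealD ?idealM.
Qed.

HB.instance Definition _ :=
  GRing.isZmodClosed.Build A (ideal_pred I) ideal_zmod_closed.
End IdealTheory.

Section IdealConstructions.
Variable A : comPzRingType.

Lemma zero_ideal_axiom : let P : {pred A} := pred1 0 in
  [/\ 0 \in P, forall x y, x \in P -> y \in P -> x + y \in P
    & forall a x, x \in P -> a * x \in P].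
Proof.
split=> [|x y|a x]; rewrite !inE //; first by move=> /eqP-> /eqP->; rewrite addr0.
by move=> /eqP->; rewrite mulr0.
Qed.
Definition zero_ideal : ideal A := Ideal zero_ideal_axiom.

Definition ideal_gen_pred (G : A -> Prop) : {pred A} := fun f =>
  `[< exists2 s : seq (A * A), (forall x, x \in s -> G x.2)
        & f = \sum_(x <- s) x.1 * x.2 >].

Lemma ideal_gen_axiom (G : A -> Prop) (P := ideal_gen_pred G) :
  [/\ 0 \in P, forall x y, x \in P -> y \in P -> x + y \in P
    & forall a x, x \in P -> a * x \in P].
Proof.
split=> [|x y /asboolP[s sG ->] /asboolP[t tG ->]|a x /asboolP[s sG ->]].
- by apply/asboolP; exists [::]; rewrite ?big_nil.
- apply/asboolP; exists (s ++ t); rewrite ?big_cat // => z.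
  by rewrite mem_cat => /orP[/sG|/tG].
- apply/asboolP; exists [seq (a * z.1, z.2) | z <- s].
    by move=> z /mapP[w /sG Gw ->].
  by rewrite big_map mulr_sumr; apply: eq_bigr => z _; rewrite mulrA.
Qed.
Definition ideal_gen G : ideal A := Ideal (ideal_gen_axiom G).

Definition ideal_sum_pred n (J : 'I_n -> ideal A) : {pred A} := fun f =>
  `[< exists2 g : 'I_n -> A, (forall i, g i \in J i) & f = \sum_i g i >].

Lemma ideal_sum_axiom n (J : 'I_n -> ideal A) (P := ideal_sum_pred J) :
  [/\ 0 \in P, forall x y, x \in P -> y \in P -> x + y \in P
    & forall a x, x \in P -> a * x \in P].
Proof.
split=> [|x y /asboolP[g gJ ->] /asboolP[k kJ ->]|a x /asboolP[g gJ ->]].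
- apply/asboolP; exists (fun=> 0) => [i|]; first exact: ideal0.
  by rewrite big1.
- apply/asboolP; exists (fun i => g i + k i) => [i|]; first by rewrite idealD.
  by rewrite big_split.
- apply/asboolP; exists (fun i => a * g i) => [i|]; first by rewrite idealM.
  by rewrite mulr_sumr.
Qed.
Definition ideal_sum n J : ideal A := Ideal (@ideal_sum_axiom n J).

Definition saturation_pred (d : A) (I : ideal A) : {pred A} := fun f =>
  `[< exists k : nat, d ^+ k * f \in I >].

Lemma saturation_axiom (d : A) (I : ideal A) (P := saturation_pred d I) :
  [/\ 0 \in P, forall x y, x \in P -> y \in P -> x + y \in P
    & forall a x, x \in P -> a * x \in P].
Proof.
split=> [|x y /asboolP[k xI] /asboolP[l yI]|a x /asboolP[k xI]].
- by apply/asboolP; exists 0%N; rewrite mulr0 ideal0.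
- apply/asboolP; exists (k + l)%N; rewrite mulrDr idealD // exprD.
    by rewrite [d ^+ k * _]mulrC -mulrA idealM.
  by rewrite -mulrA idealM.
- by apply/asboolP; exists k; rewrite mulrCA idealM.
Qed.
Definition saturation d I : ideal A := Ideal (saturation_axiom d I).

End IdealConstructions.

Section QuotientRing.
Variables (A : comPzRingType) (I : ideal A).

Definition quotient_ring := {ideal_quot (ideal_pred I)}.
HB.instance Definition _ := GRing.Zmodule.on quotient_ring.
HB.instance Definition _ := EqQuotient.on quotient_ring.

Let Q := quotient_ring.

Lemma quotient_eqP (x y : A) : reflect (\pi_Q x = \pi_Q y) (x - y \in I).
Proof. by rewrite (Quotient.idealrBE (ideal_pred I)); apply: eqP. Qed.

Lemma quotient_piD (x y : A) : \pi_Q (x + y) = \pi_Q x + \pi_Q y.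
Proof. exact: (Quotient.pi_add (ideal_pred I)). Qed.

Definition quotient_mul (x y : Q) : Q := \pi_Q (repr x * repr y).

Lemma quotient_piM (x y : A) : \pi_Q (x * y) = quotient_mul (\pi_Q x) (\pi_Q y).
Proof.
apply/quotient_eqP.
have hx : x - repr (\pi_Q x) \in I by apply/quotient_eqP; rewrite reprK.
have hy : y - repr (\pi_Q y) \in I by apply/quotient_eqP; rewrite reprK.
set x' := repr _ in hx *; set y' := repr _ in hy *.
have -> : x * y - x' * y' = y * (x - x') + x' * (y - y').
  by rewrite !mulrBr [y * x]mulrC [y * x']mulrC addrA subrK.
by rewrite idealD ?idealM.
Qed.

Lemma quotient_mulA : associative quotient_mul.
Proof.
elim/quotW=> x; elim/quotW=> y; elim/quotW=> z.
by rewrite -(quotient_piM y z) -(quotient_piM x y) -!quotient_piM mulrA.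
Qed.

Lemma quotient_mulC : commutative quotient_mul.
Proof.
elim/quotW=> x; elim/quotW=> y.
by rewrite -(quotient_piM x y) -(quotient_piM y x) mulrC.
Qed.

Lemma quotient_mul1 : left_id (\pi_Q 1) quotient_mul.
Proof. by elim/quotW=> x; rewrite -quotient_piM mul1r. Qed.

Lemma quotient_mulDl : left_distributive quotient_mul +%R.
Proof.
elim/quotW=> x; elim/quotW=> y; elim/quotW=> z.
rewrite -(quotient_piM x z) -(quotient_piM y z) -!quotient_piD.
by rewrite -(quotient_piM (x + y) z) mulrDl.
Qed.

HB.instance Definition _ := GRing.Zmodule_isComPzRing.Build quotient_ring
  quotient_mulA quotient_mulC quotient_mul1 quotient_mulDl.

End QuotientRing.

Record prime_ideal (A : comPzRingType) := PrimeIdeal {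
  prime_ideal_ideal :> ideal A;
  prime_ideal_proper : 1 \notin prime_ideal_ideal;
  prime_ideal_prime : forall x y, x * y \in prime_ideal_ideal ->
    x \in prime_ideal_ideal \/ y \in prime_ideal_ideal }.

Section Localization.
Variables (A : comPzRingType) (p : prime_ideal A).

Definition denom := {s : A | s \notin p}.
Definition one_denom : denom := exist (fun s : A => is_true (s \notin p)) 1 (prime_ideal_proper p).

Lemma denomM_subproof (s t : denom) : val s * val t \notin p.
Proof.
apply/negP => /prime_ideal_prime[]; first exact/negP/(valP s).
exact/negP/(valP t).
Qed.
Definition denomM (s t : denom) : denom :=
  exist (fun s : A => is_true (s \notin p)) _ (denomM_subproof s t).

Definition fraction := (A * denom)%type.

Definition fraction_eqv (x y : fraction) : bool :=
  `[< exists u : denom, val u * (x.1 * val y.2) = val u * (y.1 * val x.2) >].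

Lemma fraction_eqv_is_equiv : equiv_class_of fraction_eqv.
Proof.
split=> [x|x y|y x z].
- by apply/asboolP; exists one_denom.
- by apply/asboolP/asboolP => -[u hu]; exists u.
- move=> /asboolP[u hu] /asboolP[v hv]; apply/asboolP.
  exists (denomM (denomM u v) y.2).
  case: x y z u v hu hv => [x1 [s hs]] [y1 [t ht]] [z1 [r hr]] [u ?] [v ?] /=.
  move=> hu hv.
  have -> : u * v * t * (x1 * r) = v * r * (u * (x1 * t)) by ring.
  have -> : u * v * t * (z1 * s) = u * s * (v * (z1 * t)) by ring.
  by rewrite hu -hv; ring.
Qed.

Canonical fraction_equiv := EquivRelPack fraction_eqv_is_equiv.
Canonical fraction_encModRel := defaultEncModRel fraction_eqv.

Definition localization := {eq_quot fraction_eqv}.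
HB.instance Definition _ := EqQuotient.on localization.
HB.instance Definition _ := Choice.on localization.

Let L := localization.

Definition frac (a : A) (s : denom) : L := \pi_L (a, s).

Lemma frac_eqP a s b t : frac a s = frac b t <->
  exists u : denom, val u * (a * val t) = val u * (b * val s).
Proof.
rewrite /frac; split=> [/eqP|h]; last first.
  by apply/eqP; rewrite eqmodE; apply/asboolP.
by rewrite eqmodE => /asboolP.
Qed.

Lemma frac_ind (P : L -> Prop) : (forall a s, P (frac a s)) -> forall x, P x.
Proof. by move=> h x; rewrite -[x]reprK; case: (repr x) => a s; apply: h. Qed.

Lemma frac_repr x : frac (repr x).1 (repr x).2 = x :> L.
Proof. by rewrite /frac -surjective_pairing reprK. Qed.

Definition loc_add (x y : L) : L :=
  let: ((a, s), (b, t)) := (repr x, repr y) in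
  frac (a * val t + b * val s) (denomM s t).
Definition loc_mul (x y : L) : L :=
  let: ((a, s), (b, t)) := (repr x, repr y) in frac (a * b) (denomM s t).
Definition loc_opp (x : L) : L := let: (a, s) := repr x in frac (- a) s.

Lemma frac_add a s b t :
  loc_add (frac a s) (frac b t) = frac (a * val t + b * val s) (denomM s t).
Proof.
rewrite /loc_add.
have := frac_repr (frac a s); case: (repr _) => a' s' /frac_eqP[u /= hu].
have := frac_repr (frac b t); case: (repr _) => b' t' /frac_eqP[v /= hv].
apply/frac_eqP; exists (denomM u v) => /=.
move: (val u) (val v) (val s) (val t) (val s') (val t') hu hv.
move=> {s t s' t' u v} u v s t s' t' hu hv.
have -> : u * v * ((a' * t' + b' * s') * (s * t)) =
  (v * t * t') * (u * (a' * s)) + (u * s * s') * (v * (b' * t)) by ring.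
by rewrite hu hv; ring.
Qed.

Lemma frac_mul a s b t : loc_mul (frac a s) (frac b t) = frac (a * b) (denomM s t).
Proof.
rewrite /loc_mul.
have := frac_repr (frac a s); case: (repr _) => a' s' /frac_eqP[u /= hu].
have := frac_repr (frac b t); case: (repr _) => b' t' /frac_eqP[v /= hv].
apply/frac_eqP; exists (denomM u v) => /=.
move: (val u) (val v) (val s) (val t) (val s') (val t') hu hv.
move=> {s t s' t' u v} u v s t s' t' hu hv.
have -> : u * v * (a' * b' * (s * t)) = (u * (a' * s)) * (v * (b' * t)) by ring.
by rewrite hu hv; ring.
Qed.

Lemma frac_opp a s : loc_opp (frac a s) = frac (- a) s.
Proof.
rewrite /loc_opp.
have := frac_repr (frac a s); case: (repr _) => a' s' /frac_eqP[u /= hu].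
by apply/frac_eqP; exists u; rewrite !mulNr !mulrN hu.
Qed.

Lemma frac_eq a s b t : a * val t = b * val s -> frac a s = frac b t.
Proof. by move=> h; apply/frac_eqP; exists one_denom; rewrite h. Qed.

Lemma loc_addA : associative loc_add.
Proof.
elim/frac_ind=> a s; elim/frac_ind=> b t; elim/frac_ind=> c r.
by rewrite !frac_add; apply: frac_eq => /=; ring.
Qed.

Lemma loc_addC : commutative loc_add.
Proof.
elim/frac_ind=> a s; elim/frac_ind=> b t.
by rewrite !frac_add; apply: frac_eq => /=; ring.
Qed.

Lemma loc_add0 : left_id (frac 0 one_denom) loc_add.
Proof. by elim/frac_ind=> a s; rewrite frac_add; apply: frac_eq => /=; ring. Qed.

Lemma loc_addN : left_inverse (frac 0 one_denom) loc_opp loc_add.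
Proof.
by elim/frac_ind=> a s; rewrite frac_opp frac_add; apply: frac_eq => /=; ring.
Qed.

Lemma loc_mulA : associative loc_mul.
Proof.
elim/frac_ind=> a s; elim/frac_ind=> b t; elim/frac_ind=> c r.
by rewrite !frac_mul; apply: frac_eq => /=; ring.
Qed.

Lemma loc_mulC : commutative loc_mul.
Proof.
elim/frac_ind=> a s; elim/frac_ind=> b t.
by rewrite !frac_mul; apply: frac_eq => /=; ring.
Qed.

Lemma loc_mul1 : left_id (frac 1 one_denom) loc_mul.
Proof. by elim/frac_ind=> a s; rewrite frac_mul; apply: frac_eq => /=; ring. Qed.

Lemma loc_mulDl : left_distributive loc_mul loc_add.
Proof.
elim/frac_ind=> a s; elim/frac_ind=> b t; elim/frac_ind=> c r.
by rewrite !(frac_add, frac_mul); apply: frac_eq => /=; ring.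
Qed.

HB.instance Definition _ := GRing.isZmodule.Build localization
  loc_addA loc_addC loc_add0 loc_addN.
HB.instance Definition _ := GRing.Zmodule_isComPzRing.Build localization
  loc_mulA loc_mulC loc_mul1 loc_mulDl.

Lemma frac0 s : frac 0 s = 0.
Proof. by apply: frac_eq; rewrite !mul0r. Qed.

Lemma frac_eq0 a s : frac a s = 0 <-> exists u : denom, val u * a = 0.
Proof.
rewrite -(frac0 one_denom); split=> [/frac_eqP|] [u hu].
  by exists u; move: hu; rewrite /= mulr1 mul0r mulr0.
by apply/frac_eqP; exists u; rewrite mul0r mulr0 mulrA hu mul0r.
Qed.

End Localization.

Definition reduced_ring (A : comPzRingType) : Prop :=
  forall (x : A) (k : nat), x ^+ k = 0 -> x = 0.

(* The points of Spec A are the prime ideals p of A, the stalk of the structure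
   sheaf at p is A_p, and a scheme is reduced when all its stalks are. *)
Definition reduced_Spec (A : comPzRingType) : Prop :=
  forall p : prime_ideal A, reduced_ring (localization p).

Lemma reduced_SpecP (A : comPzRingType) : reduced_Spec A <-> reduced_ring A.
Proof.
split=> [redA a k ak0|redA p x k].
  apply: contrapT => a_neq0.
  have ann_ax : let P : {pred A} := fun x => x * a == 0 in
    [/\ 0 \in P, forall x y, x \in P -> y \in P -> x + y \in P
      & forall b x, x \in P -> b * x \in P].
    split=> [|x y|b x]; rewrite !unfold_in ?mul0r //.
      by move=> /eqP x0 /eqP y0; rewrite mulrDl x0 y0 addr0.
    by move=> /eqP x0; rewrite -mulrA x0 mulr0.
  pose ann : ideal A := Ideal ann_ax.
  have [p annp] : exists p : prime_ideal A, {subset ann <= p}.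
    pose good (P : A -> bool) := exists I : ideal A,
      [/\ forall x, (x \in I) = P x, {subset ann <= I} & 1 \notin I].
    pose T := {P : A -> bool | good P}.
    pose le (P Q : T) := `[< forall x, sval P x -> sval Q x >].
    have good_ann : good (fun x => x * a == 0).
      by exists ann; split=> //; apply/negP => /eqP; rewrite mul1r.
    have le_refl P : le P P by apply/asboolP.
    have le_trans P Q S : le P Q -> le Q S -> le P S.
      by move=> /asboolP PQ /asboolP QS; apply/asboolP => x /PQ /QS.
    have chain (S : T -> Prop) : classical_sets.total_on S le ->
        exists P, forall Q, S Q -> le Q P.
      move=> totS; case: (pselect (exists J, S J)) => [[J0 SJ0]|noJ]; last first.
        by exists (exist _ _ good_ann) => J SJ; case: noJ; exists J.
      have U_ax : let P : {pred A} :=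
          fun x => `[< exists2 J : T, S J & sval J x >] in
        [/\ 0 \in P, forall x y, x \in P -> y \in P -> x + y \in P
          & forall b x, x \in P -> b * x \in P].
        split=> [|x y /asboolP[J SJ xJ] /asboolP[L SL yL]|b x /asboolP[J SJ xJ]].
        - apply/asboolP; exists J0 => //; have [I [<- _ _]] := svalP J0.
          exact: ideal0.
        - apply/asboolP; case: (totS J L SJ SL) => /asboolP JL.
            exists L => //; move: {JL xJ}(JL _ xJ) yL.
            by have [I [IE _ _]] := svalP L; rewrite -!IE; apply: idealD.
          exists J => //; move: xJ {JL yL}(JL _ yL).
          by have [I [IE _ _]] := svalP J; rewrite -!IE; apply: idealD.
        - apply/asboolP; exists J => //; move: xJ.
          by have [I [IE _ _]] := svalP J; rewrite -!IE; apply: idealM.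
      have U1 : good (fun x => `[< exists2 J : T, S J & sval J x >]).
        exists (Ideal U_ax); split=> // [x xann|].
          apply/asboolP; exists J0 => //.
          by have [I [<- annI _]] := svalP J0; apply: annI.
        apply/negP => /asboolP -[J _].
        by have [I [<- _ /negP]] := svalP J.
      exists (exist _ _ U1) => J SJ; apply/asboolP => x xJ.
      by apply/asboolP; exists J.
    have [[P [M [ME annM M1]]] maxM] :=
      classical_sets.ZL_preorder (exist _ _ good_ann : T) le_refl
        (fun J I L => @le_trans J I L) chain.
    have M_prime x y : x * y \in M -> x \in M \/ y \in M.
      move=> xyM; case: (boolP (x \in M)) => [|xM]; [by left|right].
      have E_ax : let P : {pred A} :=
          fun z => `[< exists2 m, m \in M & exists b, z = m + b * x >] in
        [/\ 0 \in P, forall u v, u \in P -> v \in P -> u + v \in P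
          & forall b u, u \in P -> b * u \in P].
        split=> [|u v /asboolP[m mM [b ->]] /asboolP[m' mM' [b' ->]]
                 |c u /asboolP[m mM [b ->]]]; apply/asboolP.
        - by exists 0; rewrite ?ideal0 //; exists 0; rewrite mul0r addr0.
        - by exists (m + m'); rewrite ?idealD //; exists (b + b'); ring.
        - by exists (c * m); rewrite ?idealM //; exists (c * b); ring.
      have subE : {subset M <= Ideal E_ax}.
        move=> m mM; apply/asboolP; exists m => //.
        by exists 0; rewrite mul0r addr0.
      case: (boolP (1 \in Ideal E_ax)) => [/asboolP[m mM [b e1]]|E1].
        have -> : y = y * m + b * (x * y).
          by rewrite -[LHS]mulr1 e1; ring.
        by apply: idealD; apply: idealM.
      have goodE : good (ideal_pred (Ideal E_ax)).
        by exists (Ideal E_ax); split=> // z /annM /subE.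
      have xE : x \in Ideal E_ax.
        by apply/asboolP; exists 0; rewrite ?ideal0 //; exists 1; ring.
      have /maxM/asboolP/(_ x xE) : le (exist _ P (ex_intro _ M (And3 ME annM M1)))
          (exist _ _ goodE).
        by apply/asboolP => z /=; rewrite -ME; apply: subE.
      by rewrite /= -ME (negPf xM).
    by exists (PrimeIdeal M1 M_prime).
  have fracX m : frac a (one_denom p) ^+ m = frac (a ^+ m) (one_denom p).
    elim: m => [|m IHm] //; rewrite !exprS IHm.
    rewrite [LHS](frac_mul a (one_denom p) (a ^+ m) (one_denom p)).
    by apply: frac_eq => /=; ring.
  have /frac_eq0[u ua0] : frac a (one_denom p) = 0.
    by apply: (redA p _ k); rewrite fracX ak0 frac0.
  by have /negP := valP u; apply; apply: annp; apply/eqP.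
elim/frac_ind: x => a s.
have [t ->] : exists t, frac a s ^+ k = frac (a ^+ k) t.
  elim: k => [|k [t IHk]]; first by exists (one_denom p).
  exists (denomM s t); rewrite !exprS IHk.
  exact: (frac_mul a s (a ^+ k) t).
move=> /frac_eq0[u uak0]; apply/frac_eq0; exists u; apply: (redA _ k.+1).
rewrite exprMn !exprS; move: (val u) uak0 => v va0.
have -> : v * v ^+ k * (a * a ^+ k) = (v * a ^+ k) * (v ^+ k * a) by ring.
by rewrite va0 mul0r.
Qed.

Definition is_hessenberg n (h : 'I_n -> 'I_n) : Prop :=
  (forall i j : 'I_n, j = i.+1 :> nat -> (h i <= h j)%N) /\
  (forall i : 'I_n, (i <= h i)%N).

(* 'I_n is {0, ..., n-1}, so the condition i < n reads i.+1 < n. *)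
Definition indecomposable n (h : 'I_n -> 'I_n) : Prop :=
  forall i : 'I_n, (i.+1 < n)%N -> (i < h i)%N.

Section MatrixHessenberg.
Variables (K : comNzRingType) (n : nat).

(* The variables are indexed by pairs (i, j) through mxvec_index. *)
Definition genericmx : 'M[{mpoly K[n * n]}]_n :=
  \matrix_(i, j) 'X_(mxvec_index i j).

(* The columns x v_1, ..., x v_i, v_1, ..., v_h(i): with i and h i counted from
   0, these are the first i.+1 columns of x Z and the first (h i).+1 of Z. *)
Definition hessenbergmx (x : 'M[K]_n) (h : 'I_n -> 'I_n) (i : 'I_n) :
    'M[{mpoly K[n * n]}]_(n, i.+1 + (h i).+1) :=
  row_mx (colsub (widen_ord (ltn_ord i))
            (map_mx (@mpolyC (n * n) K) x *m genericmx))
         (colsub (widen_ord (ltn_ord (h i))) genericmx).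

Definition is_minor (A : comNzRingType) m q r (M : 'M[A]_(m, q)) (f : A) : Prop :=
  exists (rows : 'I_r -> 'I_m) (cols : 'I_r -> 'I_q),
    [/\ {homo rows : a b / (a < b)%N}, {homo cols : a b / (a < b)%N}
      & f = \det (mxsub rows cols M)].

Definition hessenberg_ideal_at (x : 'M[K]_n) (h : 'I_n -> 'I_n) (i : 'I_n) :
    ideal {mpoly K[n * n]} :=
  if ((h i).+1 < n)%N then ideal_gen (is_minor (h i).+2 (hessenbergmx x h i))
  else zero_ideal _.

Definition hessenberg_ideal (x : 'M[K]_n) (h : 'I_n -> 'I_n) :
    ideal {mpoly K[n * n]} :=
  ideal_sum (hessenberg_ideal_at x h).

Definition matrix_hessenberg_ideal (x : 'M[K]_n) (h : 'I_n -> 'I_n) :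
    ideal {mpoly K[n * n]} :=
  saturation (\det genericmx) (hessenberg_ideal x h).

(* The matrix Hessenberg scheme is Spec of this ring. *)
Definition matrix_hessenberg_ring (x : 'M[K]_n) (h : 'I_n -> 'I_n) :
    comPzRingType :=
  quotient_ring (matrix_hessenberg_ideal x h).

(* The matrix unit E_{1n}. *)
Definition min_nilpotent : 'M[K]_n :=
  \matrix_(i, j) ((i == 0 :> nat) && (j.+1 == n :> nat))%:R.

End MatrixHessenberg.

(* Main.v *)
Require Import Defs.
From HB Require Import structures.
From mathcomp Require Import all_boot all_order all_algebra.
From mathcomp Require Import reals complex.
From mathcomp Require Import fingroup perm generic_quotient boolp ring mpoly.

Set Implicit Arguments.
Unset Strict Implicit.
Unset Printing Implicit Defensive.

Import GRing.Theory.
Local Open Scope ring_scope.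

(** Write y_j for the entries of the last row of the generic matrix Z, c_j for
    the cofactors of its first row, and d for det Z; indices are counted from 0.
    The vector c / d is the first column of the inverse of Z, and the sum of the
    products y_j c_j is zero because the first and last rows differ.  For the
    nilpotent E_1n the column x v_j is y_j e_1, so a nonzero minor uses at most
    one column of x Z.  Up to saturation by d, the ideal is generated by the
    products y_a c_b with h a < b ([mem_hessenberg], [hessenberg_sub]): a
    squarefree monomial ideal in the pair (y, c), which is subject to the single
    relation y . c = 0.

    If h a = a for some a that is not the last index, let p be the partial sum
    of the y_j c_j with j <= a.  As p is also minus the sum of the other terms,
    p^2 is a combination of products y_j c_k with j <= a < k, so p is nilpotent.
    It is not zero: along the first-order deformation 1 + X E_n1 of the identity
    the generators vanish modulo X^2, while d = 1 and p = X
    ([partial_trace_sqr], [partial_trace_notin]).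

    Let h be indecomposable.  Put F_i = I + (y_j : j < i) and
    J_i = (y_j : j < i) + (c_b : b > h i).  Then F_i is contained in the
    saturation of J_i, y_i J_i is contained in F_i, and F_(i+1) = F_i + (y_i).
    If the saturation of J_i is prime and does not contain y_i, an f with a
    power in F_i lies in J_i and, by descending induction, in F_(i+1), that is,
    f = u + r y_i with u in F_i; then r lies in J_i and f in F_i, all up to
    saturation
    ([filtration_radical_step]).  The induction starts at F_n, which contains d.

    The primality of J_i is the heart ([component_prime]).  Where y_s is
    invertible, the relation y . c = 0 solves for c_s, and the vanishing of any
    set of the y_j and c_b with j, b <> s defines a retract of the space of
    matrices: an explicit rational matrix Z* that lies on this locus and is
    congruent to Z modulo its ideal.  Hence that ideal is, locally, the kernel
    of the substitution of Z* for Z, with values in a field, and it is prime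
    ([chart_prime]).  This covers J_i where y_s is invertible for some s in
    [i, h i].  Where y_s is invertible with s > h i, the function c_s, on the
    locus of the other equations, is up to a unit the quadric given by the sum
    of the y_j c_j for i <= j <= h i; indecomposability gives it at least two
    terms, so that y_(h i) does not divide zero modulo it
    ([component_nzd_quadric]).  Thus y_(h i) is a nonzerodivisor modulo J_i
    everywhere, and J_i is prime because it is so where y_(h i) is invertible. *)

(** * Ideals, saturation and radicals *)

Section Ideals.
Variable A : comPzRingType.
Implicit Types (G : A -> Prop) (I J : ideal A) (d f g u : A).

Lemma mem_ideal_gen G g : G g -> g \in ideal_gen G.
Proof.
move=> Gg; apply/asboolP; exists [:: (1, g)]; last by rewrite big_seq1 mul1r.
by move=> x; rewrite inE => /eqP->.
Qed.

Lemma ideal_gen_sub G J :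
  (forall g, G g -> g \in J) -> {subset ideal_gen G <= J}.
Proof.
move=> GJ f /asboolP[s sG ->]; rewrite big_seq.
by apply: rpred_sum => x xs; apply/idealM/GJ/sG.
Qed.

Lemma ideal_gen_adjoin G H u f : (forall g, G g -> H g \/ g = u) ->
  f \in ideal_gen G -> exists r, f - r * u \in ideal_gen H.
Proof.
move=> GH /asboolP[s sG ->] {f}; elim: s sG => [|x s IHs] sG.
  by exists 0; rewrite big_nil mul0r subr0 ideal0.
have [r hr] : exists r, \sum_(x <- s) x.1 * x.2 - r * u \in ideal_gen H.
  by apply: IHs => z zs; apply: sG; rewrite inE zs orbT.
rewrite big_cons; case: (GH x.2) => [|Hx|->]; first by apply: sG; rewrite inE eqxx.
  by exists r; rewrite -addrA idealD // idealM // mem_ideal_gen.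
by exists (x.1 + r); rewrite mulrDl opprD addrACA subrr add0r.
Qed.

Lemma mem_saturation d J f : reflect (exists k, d ^+ k * f \in J) (f \in saturation d J).
Proof. exact: asboolP. Qed.

Lemma sub_saturation d J : {subset J <= saturation d J}.
Proof. by move=> f fJ; apply/mem_saturation; exists 0; rewrite expr0 mul1r. Qed.

Lemma saturationS d I J :
  {subset I <= saturation d J} -> {subset saturation d I <= saturation d J}.
Proof.
move=> IJ f /mem_saturation[k /IJ /mem_saturation[l fJ]].
by apply/mem_saturation; exists (l + k)%N; rewrite exprD -mulrA.
Qed.

Lemma saturation_mull d J f k : d ^+ k * f \in saturation d J -> f \in saturation d J.
Proof.
case/mem_saturation=> l fJ.
by apply/mem_saturation; exists (l + k)%N; rewrite exprD -mulrA.
Qed.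

Lemma saturation_mulr a d J : {subset saturation d J <= saturation (a * d) J}.
Proof.
move=> f /mem_saturation[k fJ]; apply/mem_saturation; exists k.
by rewrite exprMn -mulrA idealM.
Qed.

(** Every term of the expansion of [(f + g) ^+ (k + l)] contains [f ^+ k] or
    [g ^+ l]. *)
Lemma radicalD J f g : (exists k, f ^+ k \in J) -> (exists l, g ^+ l \in J) ->
  exists m, (f + g) ^+ m \in J.
Proof.
move=> [k fJ] [l gJ]; exists (k + l)%N; rewrite exprDn rpred_sum // => i _.
rewrite rpredMn //; have [li|il] := leqP l i.
  by rewrite -(subnK li) exprD mulrA idealM.
by rewrite -addnBA 1?ltnW // addnC exprD mulrAC idealM.
Qed.

(** Membership in a colon ideal turns a statement about all multiples of [f]
    into one that only has to be checked on generators. *)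
Definition colon_pred J f : {pred A} := fun g => g * f \in J.

Lemma colon_axiom J f (P := colon_pred J f) :
  [/\ 0 \in P, forall x y, x \in P -> y \in P -> x + y \in P
    & forall a x, x \in P -> a * x \in P].
Proof.
split=> [|a b|a b].
- by change (0 * f \in J); rewrite mul0r ideal0.
- by change (a * f \in J -> b * f \in J -> (a + b) * f \in J);
    rewrite mulrDl; apply: idealD.
- by change (b * f \in J -> a * b * f \in J); rewrite -mulrA; apply: idealM.
Qed.
Definition colon J f : ideal A := Ideal (colon_axiom J f).

Lemma mem_colon J f g : (g \in colon J f) = (g * f \in J).
Proof. by []. Qed.

(** If the [y s] have [d] as a linear combination, the open sets where [y s * d]
    is invertible cover the one where [d] is: [d ^+ 2] lies in the radical of
    the ideal of those [g] with [g * f] in [J]. *)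
Lemma saturation_cover n (y c : 'I_n -> A) J f : let d := \sum_s y s * c s in
  (forall s, f \in saturation (y s * d) J) -> f \in saturation d J.
Proof.
move=> d fJ.
have [m] : exists m, (\sum_s y s * c s * d) ^+ m \in colon J f.
  apply: (big_ind (fun g => exists m, g ^+ m \in colon J f)).
  - by exists 1%N; rewrite expr1 ideal0.
  - exact: radicalD.
  - move=> s _; have /mem_saturation[k fJk] := fJ s; exists k.
    by rewrite mulrAC exprMn [_ * c s ^+ k]mulrC idealM // mem_colon.
rewrite -mulr_suml -/d => dm; apply/mem_saturation; exists (m + m)%N.
by rewrite exprD -exprMn -mem_colon.
Qed.

Lemma prod_congr J (T : finType) (a b : T -> A) :
  (forall i, a i - b i \in J) -> \prod_i a i - \prod_i b i \in J.
Proof.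
move=> ab; apply: (big_ind2 (fun x y => x - y \in J)) => //.
  by rewrite subrr ideal0.
move=> x1 x2 y1 y2 h1 h2.
have -> : x1 * y1 - x2 * y2 = y1 * (x1 - x2) + x2 * (y1 - y2) by ring.
by rewrite idealD ?idealM.
Qed.

Lemma det_congr J n (M N : 'M[A]_n) :
  (forall i j, M i j - N i j \in J) -> \det M - \det N \in J.
Proof.
move=> MN; rewrite /determinant -sumrB rpred_sum // => s _.
by rewrite -mulrBr idealM // prod_congr.
Qed.

(** Being the whole ring is allowed: a chart may miss the locus that an ideal
    defines, and the arguments below hold there trivially. *)
Definition prime_or_unit J := forall f g, f * g \in J -> f \in J \/ g \in J.

Lemma prime_or_unitX J f k : prime_or_unit J -> f ^+ k \in J -> f \in J.
Proof.
move=> Jp; elim: k => [|k IHk]; rewrite ?expr0 ?exprS.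
  by move=> J1; rewrite -[f]mulr1 idealM.
by case/Jp.
Qed.

Lemma ideal1 J f : 1 \in J -> f \in J.
Proof. by move=> J1; rewrite -[f]mulr1 idealM. Qed.

End Ideals.

Lemma reduced_quotientP (A : comPzRingType) (J : ideal A) :
  reduced_ring (quotient_ring J) <-> (forall f k, f ^+ k \in J -> f \in J).
Proof.
have pi0 f : \pi_(quotient_ring J)%qT f = 0 <-> f \in J.
  rewrite -[f in f \in J]subr0 -(rwP (quotient_eqP J f 0)).
  suff -> : \pi_(quotient_ring J)%qT 0 = 0 by [].
  by apply: (addrI (\pi_(quotient_ring J)%qT 0)); rewrite -quotient_piD !addr0.
have piX f k : \pi_(quotient_ring J)%qT (f ^+ k) = (\pi_(quotient_ring J)%qT f) ^+ k.
  elim: k => [|k IHk] //; rewrite !exprS quotient_piM IHk //.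
split=> red f k; first by rewrite -!pi0 piX; apply: red.
elim/quotW: f => f; rewrite -piX !pi0; apply: red.
Qed.

(** * The Hessenberg ideal of the minimal nilpotent matrix *)

Lemma mem_ideal_sum (A : comPzRingType) n (J : 'I_n -> ideal A) i f :
  f \in J i -> f \in ideal_sum J.
Proof.
move=> fJ; apply/asboolP; exists (fun j => if j == i then f else 0).
  by move=> j; case: eqP => [->|_] //; apply: ideal0.
by rewrite -big_mkcond big_pred1_eq.
Qed.

Lemma ideal_sum_sub (A : comPzRingType) n (J : 'I_n -> ideal A) (I : ideal A) :
  (forall i, {subset J i <= I}) -> {subset ideal_sum J <= I}.
Proof.
move=> JI f /asboolP[g gJ ->]; apply: rpred_sum => i _; exact/JI/gJ.
Qed.

(** Cramer's rule for the right-hand side [l *: e_i0]. *)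
Lemma cofactor_solution (R : comNzRingType) n (M : 'M[R]_n) i0 (w : 'I_n -> R) l :
  (forall i, \sum_j M i j * w j = l *+ (i == i0)) ->
  forall j, l * cofactor M i0 j = \det M * w j.
Proof.
move=> Mw j; pose W := \col_j w j.
have MW : M *m W = l *: delta_mx i0 0.
  apply/matrixP=> i k; rewrite !mxE ord1 eqxx andbT mulr_natr -Mw.
  by apply: eq_bigr => p _; rewrite mxE.
have: \adj M *m (M *m W) = \det M *: W.
  by rewrite mulmxA mul_adj_mx mul_scalar_mx.
rewrite MW -scalemxAr -colE => /matrixP/(_ j 0).
by rewrite !mxE.
Qed.

(** Padding both factors with zeros makes them square, and the left one then
    has a zero column. *)
Lemma det_mul_thin (R : comNzRingType) s (U : 'M[R]_(s.+1, s)) (V : 'M_(s, s.+1)) :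
  \det (U *m V) = 0.
Proof.
have -> : U *m V = @row_mx _ s.+1 1 s 0 U *m @col_mx _ 1 s s.+1 0 V.
  by rewrite mul_row_col mul0mx add0r.
rewrite (@det_mulmx _ s.+1) (expand_det_col _ ord0) big1 ?mul0r // => i _.
have -> : @row_mx _ s.+1 1 s 0 U i (ord0 : 'I_s.+1) =
  row_mx 0 U i (lshift s (ord0 : 'I_1)).
  by congr (row_mx _ _ _ _); apply: val_inj.
by rewrite row_mxEl mxE mul0r.
Qed.

(** Expansion along the last column writes an [r.+1]-minor on the first columns
    as a combination of [r]-minors on the first columns.  Rows stay in
    increasing order, as minors require; columns are indexed by [nat] so that
    dropping the last one does not change the family. *)
Lemma laplace_minors (A : comNzRingType) (J : ideal A) m (M : 'I_m -> nat -> A) s :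
    (forall f : 'I_s -> 'I_m, {homo f : a b / (a < b)%N} ->
       \det (\matrix_(i < s, j < s) M (f i) j) \in J) ->
  forall r (f : 'I_r -> 'I_m), (s <= r)%N -> {homo f : a b / (a < b)%N} ->
    \det (\matrix_(i < r, j < r) M (f i) j) \in J.
Proof.
move=> base r f sr; move: f; rewrite -(subnK sr).
elim: (r - s)%N => {r sr} [|k IHk] f f_homo.
  exact: base.
rewrite (expand_det_col _ ord_max) rpred_sum // => i _.
rewrite idealM // /cofactor idealM //.
have -> : row' i (col' ord_max (\matrix_(i < k.+1 + s, j < k.+1 + s) M (f i) j)) =
    \matrix_(p < k + s, q < k + s) M (f (lift i p)) q.
  by apply/matrixP=> p q; rewrite !mxE lift_max.
apply: (IHk (fun p => f (lift i p))) => p q pq; apply: f_homo.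
rewrite /= /bump; case: (leqP i p) => ip; case: (leqP i q) => iq //=.
  by have := leq_trans iq (leq_trans ip (ltnW pq)); rewrite ltnn.
by rewrite add0n add1n ltnS ltnW.
Qed.

Lemma row_cofactor (R : comNzRingType) n (M : 'M[R]_n) i i0 :
  \sum_j M i j * cofactor M i0 j = \det M *+ (i == i0).
Proof.
have /matrixP/(_ i i0) := mul_mx_adj M; rewrite !mxE => <-.
by apply: eq_bigr => j _; rewrite mxE.
Qed.

Lemma min_nilpotent_mul (K : comNzRingType) m p (M : 'M[{mpoly K[p]}]_m.+2) i j :
  (map_mx (@mpolyC p K) (min_nilpotent K m.+2) *m M) i j = M ord_max j *+ (i == ord0).
Proof.
rewrite mxE (bigD1 ord_max) //= big1 ?addr0 => [|k kn].
  rewrite !mxE eqxx andbT -val_eqE.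
  by case: eqP => _; rewrite ?mpolyC1 ?mul1r // mpolyC0 mul0r.
rewrite !mxE (_ : (k.+1 == m.+2) = false) ?andbF ?mpolyC0 ?mul0r //.
by apply: contraNF kn; rewrite eqSS -val_eqE.
Qed.

Section Generic.
Variables (K : comNzRingType) (m : nat).
Local Notation n := m.+2.
Local Notation Z := (genericmx K n).
Local Notation y j := (Z ord_max j).
Local Notation c j := (cofactor Z ord0 j).
Local Notation d := (\det Z).
Implicit Type h : 'I_n -> 'I_n.

(** The cofactor [c b] is a minor whose first [(h a).+1] columns are those of
    [Z], since they come before column [b].  By Laplace expansion it suffices to
    treat the maximal minors of these columns that avoid row 0; such a minor
    times [y a] is the minor obtained by adding row 0 and the column [x v_a],
    whose only nonzero entry is [y a], in that row. *)
Lemma mem_hessenberg h (a b : 'I_n) : (h a < b)%N ->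
  y a * c b \in hessenberg_ideal (min_nilpotent K n) h.
Proof.
move=> hab; apply: (@mem_ideal_sum _ _ _ a); rewrite /hessenberg_ideal_at.
rewrite (leq_ltn_trans hab (ltn_ord b)).
rewrite /hessenbergmx; move: (genericmx K n) => Z.
set I := ideal_gen _; rewrite mulrC -mem_colon /cofactor idealM //.
pose M (i : 'I_m.+1) (j : nat) : {mpoly K[n * n]} :=
  Z (lift ord0 i) (inord (bump b j)).
have -> : row' ord0 (col' b Z) = \matrix_(i, j) M i j.
  apply/matrixP=> i j; rewrite [RHS]mxE mxE mxE; congr (Z _ _).
  by apply: val_inj; rewrite /= inordK //; apply: (ltn_ord (lift b j)).
apply: (@laplace_minors _ (colon I (Z ord_max a)) _ M (h a).+1 _ m.+1 id) => //.
  move=> f f_homo.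
  rewrite mem_colon mulrC; apply: mem_ideal_gen.
  exists (fun k => if unlift ord0 k is Some i then lift ord0 (f i) else ord0).
  exists (fun k => if unlift ord0 k is Some i then rshift a.+1 i
                   else lshift (h a).+1 ord_max).
  split.
  - move=> p q; case: unliftP => [p' ->|->]; case: unliftP => [q' ->|->] //=.
    by rewrite /bump !add1n !ltnS; apply: f_homo.
  - move=> p q; case: unliftP => [p' ->|->]; case: unliftP => [q' ->|->] //=.
      by rewrite /bump !add1n ltnS ltn_add2l.
    by move=> _; rewrite ltn_addr.
  rewrite [RHS](expand_det_col _ ord0) big_ord_recl big1 ?addr0 => [|i _].
    rewrite /cofactor addn0 expr0 mul1r.
    apply: (f_equal2 *%R); last apply: (f_equal (@determinant _ (h a).+1)).
      rewrite mxE unlift_none row_mxEl mxE min_nilpotent_mul mulr1n.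
      by congr (Z _ _); apply: val_inj.
    apply/matrixP=> i j; do 2 rewrite [RHS]mxE; rewrite mxE [RHS]mxE !liftK row_mxEr mxE /M.
    have jb : (j < b)%N := leq_trans (ltn_ord j) hab.
    congr (Z _ _); apply: val_inj; rewrite /= /bump leqNgt jb add0n inordK //.
    exact: ltn_trans jb (ltn_ord b).
  by rewrite mxE liftK unlift_none row_mxEl mxE min_nilpotent_mul mul0r.
exact: leq_trans hab (ltn_ord b).
Qed.

(** By Cramer's rule, [d *: e_1] is the combination of the columns of [Z] with
    coefficients [c q].  Modulo [J], the multiple [y j] of this relation, for
    [j <= a], involves only the first [(h a).+1] columns of [Z].  So [d] times
    the matrix that defines the minors factors through rank [(h a).+1] modulo
    [J], and its larger minors vanish. *)
Lemma hessenberg_sub h (J : ideal {mpoly K[n * n]}) :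
    {homo h : i j / (i <= j)%N} ->
    (forall a b : 'I_n, (h a < b)%N -> y a * c b \in J) ->
  {subset hessenberg_ideal (min_nilpotent K n) h <= saturation d J}.
Proof.
move=> h_homo; rewrite /hessenberg_ideal /hessenberg_ideal_at /hessenbergmx.
move: (genericmx K n) => Z ycJ; apply: ideal_sum_sub => a.
case: ifP => [ha|_] f; last first.
  by move=> /eqP ->; apply: ideal0.
apply: ideal_gen_sub f => _ [rows [cols [_ _ ->]]].
apply/mem_saturation; exists (h a).+2; rewrite -detZ.
pose U : 'M_((h a).+2, (h a).+1) :=
  \matrix_(p, q) Z (rows p) (widen_ord (ltn_ord (h a)) q).
pose V : 'M_((h a).+1, (h a).+2) := \matrix_(q, k)
  match split (cols k) with
  | inl j => Z ord_max (widen_ord (ltn_ord a) j) * cofactor Z ord0 (widen_ord (ltn_ord (h a)) q)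
  | inr j => \det Z *+ (q == j)
  end.
rewrite -[X in X \in J]subr0 -(det_mul_thin U V); apply: det_congr => p k.
have -> : (U *m V) p k = \sum_(q < (h a).+1) Z (rows p) (widen_ord (ltn_ord (h a)) q) *
    match split (cols k) with
    | inl j => Z ord_max (widen_ord (ltn_ord a) j) * cofactor Z ord0 (widen_ord (ltn_ord (h a)) q)
    | inr j => \det Z *+ (q == j)
    end.
  by rewrite mxE; apply: eq_bigr => q _; rewrite !mxE.
rewrite 2!mxE; case: (split_ordP (cols k)) => j ->.
  rewrite row_mxEl mxE min_nilpotent_mul.
  set j' := widen_ord _ j.
  have -> : \det Z * (Z ord_max j' *+ (rows p == ord0)) = \sum_q Z (rows p) q * (Z ord_max j' * cofactor Z ord0 q).
    rewrite mulrnAr mulrC -mulrnAr -row_cofactor mulr_sumr.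
    by apply: eq_bigr => q _; rewrite mulrCA.
  rewrite (bigID (fun q : 'I_n => (q < (h a).+1)%N)) /=.
  rewrite (big_ord_narrow (ltn_ord (h a))) /= addrAC subrr add0r.
  rewrite rpred_sum // => q; rewrite -leqNgt => hq; rewrite idealM // ycJ //.
  by apply: leq_ltn_trans hq; apply: h_homo; apply: (ltn_ord j).
rewrite row_mxEr mxE (bigD1 j) //= big1 ?addr0 => [|q qj]; last first.
  by rewrite (negPf qj) mulr0.
by rewrite eqxx mulrC subrr ideal0.
Qed.

End Generic.

(** * Rational retractions *)

Local Notation "x %:F" := (FracField.tofrac x).
Section Evaluation.
Variables (K : comNzRingType) (n : nat) (L : comNzRingType).
Variables (phi : {rmorphism K -> L}) (M : 'M[L]_n).

(** Substitution of a matrix for the generic one. *)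
Definition mxeval : {mpoly K[n * n]} -> L := mmap phi (fun t => mxvec M 0 t).
HB.instance Definition _ := GRing.RMorphism.on mxeval.

Lemma mxevalX i j : mxeval (genericmx K n i j) = M i j.
Proof. by rewrite mxE /mxeval mmapX mmap1U mxvecE. Qed.

Lemma map_genericmx : map_mx mxeval (genericmx K n) = M.
Proof. by apply/matrixP=> i j; rewrite mxE mxevalX. Qed.

Lemma mxeval_det : mxeval (\det (genericmx K n)) = \det M.
Proof. by rewrite -det_map_mx map_genericmx. Qed.

Lemma mxeval_cofactor i j : mxeval (cofactor (genericmx K n) i j) = cofactor M i j.
Proof. by rewrite -cofactor_map_mx map_genericmx. Qed.
End Evaluation.

Lemma genericmx_neq0 (K : comNzRingType) n i j : genericmx K n i j != 0.
Proof. by rewrite mxE -msupp_eq0 msuppX. Qed.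

Lemma mpoly_ring_ind (K : comNzRingType) n (P : {mpoly K[n]} -> Prop) :
    (forall a, P a%:MP) -> (forall i, P 'X_i) ->
    (forall f g, P f -> P g -> P (f + g)) ->
    (forall f g, P f -> P g -> P (f * g)) ->
  forall f, P f.
Proof.
move=> PC PX PD PM; apply: mpolyind => [|a mon f _ _ Pf].
  by rewrite -mpolyC0.
apply: (PD) => //; rewrite -mul_mpolyC; apply: (PM) => //.
rewrite mpolyXE_id; apply: (big_ind P) => [||i _]; [by rewrite -mpolyC1 | exact: PM |].
by elim: (mon i) => [|k IHk]; rewrite ?expr0 -?mpolyC1 // exprS; apply: PM.
Qed.

Section Fraction.
Variables (K : fieldType) (n : nat).
Local Notation P := {mpoly K[n * n]}.
Local Notation Z := (genericmx K n).
Variables (J : ideal P) (D : P) (N : 'I_n -> 'I_n -> P).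
Hypotheses (D_neq0 : D != 0) (ND : forall i j, N i j - D * Z i j \in J).

Definition frac_mx : 'M[{fraction P}]_n :=
  \matrix_(i, j) ((N i j)%:F / D%:F).
Definition frac_eval : P -> {fraction P} :=
  mxeval (@FracField.tofrac P \o @mpolyC (n * n) K) frac_mx.
HB.instance Definition _ := GRing.RMorphism.on frac_eval.

(** Clearing denominators in [f (N / D)] gives a polynomial [F] which, because
    [N] is congruent to [D *: Z], is congruent to [D ^+ e * f]. *)
Lemma frac_eval_congr f : exists e F,
  F%:F = D%:F ^+ e * frac_eval f /\ F - D ^+ e * f \in J.
Proof.
have DF0 : D%:F != 0 :> {fraction P} by rewrite tofrac_eq0.
elim/mpoly_ring_ind: f.
- move=> a; exists 0%N, a%:MP; rewrite expr0 !mul1r subrr ideal0; split=> //.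
  by rewrite /frac_eval /mxeval mmapC.
- move=> k; case/mxvec_indexP: k => i j; exists 1%N, (N i j).
  have -> : 'X_(mxvec_index i j) = Z i j by rewrite mxE.
  by rewrite !expr1 ND /frac_eval mxevalX mxE mulrC divfK.
- move=> f g [e [F [Fe FJ]]] [e' [G [Ge GJ]]].
  exists (e + e')%N, (D ^+ e' * F + D ^+ e * G); split.
    rewrite !(tofracD, tofracM, tofracXn) Fe Ge rmorphD exprD /=; ring.
  rewrite exprD.
  have -> : D ^+ e' * F + D ^+ e * G - D ^+ e * D ^+ e' * (f + g) =
    D ^+ e' * (F - D ^+ e * f) + D ^+ e * (G - D ^+ e' * g) by ring.
  by rewrite idealD ?idealM.
- move=> f g [e [F [Fe FJ]]] [e' [G [Ge GJ]]].
  exists (e + e')%N, (F * G); split.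
    rewrite tofracM Fe Ge rmorphM exprD /=; ring.
  rewrite exprD.
  have -> : F * G - D ^+ e * D ^+ e' * (f * g) =
    G * (F - D ^+ e * f) + D ^+ e * f * (G - D ^+ e' * g) by ring.
  by rewrite idealD ?idealM.
Qed.

Lemma frac_eval_ker f : frac_eval f = 0 -> exists e, D ^+ e * f \in J.
Proof.
move=> f0; have [e [F [Fe FJ]]] := frac_eval_congr f.
exists e; move: FJ; have /eqP : F%:F = 0 by rewrite Fe f0 mulr0.
by rewrite tofrac_eq0 => /eqP ->; rewrite sub0r rpredN.
Qed.
End Fraction.

Lemma hessenberg_homo n (h : 'I_n -> 'I_n) :
  is_hessenberg h -> {homo h : i j / (i <= j)%N}.
Proof.
case=> h_step _ i j /subnKC; move: (j - i)%N => k.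
elim: k j => [|k IHk] j ij.
  by rewrite (_ : i = j) //; apply: val_inj; rewrite /= -ij addn0.
have jn : (i + k < n)%N by rewrite -addnS ij ltnW.
apply: leq_trans (IHk (Ordinal jn) _) (h_step _ _ _) => //=.
by rewrite -ij addnS.
Qed.

Section MinimalNilpotent.
Variables (K : fieldType) (m : nat).
Local Notation n := m.+2.
Local Notation P := {mpoly K[n * n]}.
Local Notation Z := (genericmx K n).
Local Notation y j := (Z ord_max j).
Local Notation c j := (cofactor Z ord0 j).
Local Notation d := (\det Z).

(** [S] and [T] select the coordinates [y j] and [c b] that are set to 0. *)
Definition cut_ideal (S T : pred 'I_n) : ideal P :=
  ideal_gen (fun f => (exists2 j, S j & f = y j) \/ (exists2 b, T b & f = c b)).

Lemma cut_idealS (S T S' T' : pred 'I_n) : subpred S S' -> subpred T T' ->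
  {subset cut_ideal S T <= cut_ideal S' T'}.
Proof.
move=> SS TT; apply: ideal_gen_sub => g [[j /SS Sj ->]|[b /TT Tb ->]].
  by apply: mem_ideal_gen; left; exists j.
by apply: mem_ideal_gen; right; exists b.
Qed.

Lemma mem_cuty (S T : pred 'I_n) j : S j -> y j \in cut_ideal S T.
Proof. by move=> Sj; apply: mem_ideal_gen; left; exists j. Qed.

Lemma mem_cutc (S T : pred 'I_n) b : T b -> c b \in cut_ideal S T.
Proof. by move=> Tb; apply: mem_ideal_gen; right; exists b. Qed.

(** At a matrix whose last row is [e_a + e_s] and for which the first column of
    the inverse is [e_a - e_s], the only nonzero terms of the full sum have
    index [a] or [s], and only the first of them is kept. *)
Lemma partial_trace_neq0 (U : pred 'I_n) s a : a != s -> U a -> ~~ U s ->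
  \sum_(j | U j) y j * c j != 0.
Proof.
move=> as_ Ua Us.
pose t : 'S_n := (tperm ord0 a * tperm (tperm ord0 a ord_max) s)%g.
have t0 : t ord0 = a.
  rewrite permM tpermL [LHS]tpermD //; last by rewrite eq_sym.
  by rewrite -[X in _ != X](tpermL ord0 a) (inj_eq perm_inj).
have tmax : t ord_max = s by rewrite permM tpermL.
pose L : 'M[K]_n := 1%:M + delta_mx ord_max ord0.
pose M := L *m perm_mx t.
have ME i j : M i j = (j == t i)%:R + ((i == ord_max) && (j == a))%:R.
  rewrite /M mulmxDl mul1mx mxE mxE [j == t i]eq_sym; congr (_ + _).
    by rewrite mxE.
  rewrite mxE (bigD1 ord0) //= big1 ?addr0 => [|k k0]; rewrite !mxE.
    by rewrite eqxx andbT t0 -natrM mulnb [a == j]eq_sym.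
  by rewrite (negPf k0) andbF mul0r.
have detM : \det M != 0.
  rewrite det_mulmx det_perm mulf_neq0 ?signr_eq0 // det_trig.
    apply/prodf_neq0 => i _.
    by rewrite !mxE eqxx; case: (eqVneq i ord0) => [->|_];
      rewrite ?andbF /= addr0 oner_eq0.
  apply/is_trig_mxP => i j ij; rewrite !mxE.
  by rewrite -!val_eqE /= (ltn_eqF ij) (ltn_eqF (leq_trans ij (leq_ord j))) addr0.
pose w j : K := (j == a)%:R - (j == s)%:R.
have Mw i : \sum_j M i j * w j = 1 *+ (i == ord0).
  rewrite (eq_bigr (fun j => M i j * (j == a)%:R - M i j * (j == s)%:R)).
    have sumE b : \sum_j M i j * (j == b)%:R = M i b.
      rewrite (bigD1 b) //= eqxx mulr1 big1 ?addr0 // => j /negPf ->.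
      by rewrite mulr0.
    rewrite sumrB !sumE !ME -{1}t0 -{1}tmax !(inj_eq perm_inj) eqxx.
    rewrite [s == a]eq_sym (negPf as_) andbF addr0 andbT.
    by rewrite [ord_max == i]eq_sym addrK [ord0 == i]eq_sym.
  by move=> j _; rewrite mulrBr.
have cM j : cofactor M ord0 j = \det M * w j.
  by rewrite -(cofactor_solution Mw) mul1r.
apply: contraNneq detM => sum0.
have := congr1 (mxeval idfun M) sum0; rewrite rmorph0 rmorph_sum (bigD1 a) //=.
rewrite big1 ?addr0 => [|j /andP[Uj ja]].
  rewrite rmorphM /= mxevalX mxeval_cofactor cM ME /w !eqxx (negPf as_) subr0 mulr1.
  by rewrite tmax (negPf as_) add0r mul1r => ->.
rewrite rmorphM /= mxeval_cofactor cM /w (negPf ja) (_ : (j == s) = false) ?subr0 ?mulr0 //.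
by apply: contraNF Us => /eqP <-.
Qed.

Section Chart.
Variables (S T : pred 'I_n) (s : 'I_n).
Hypotheses (Ss : ~~ S s) (Ts : ~~ T s).
Local Notation E := (cut_ideal S T).

(** The retraction [Zstar / D].  The last row becomes [ystar] and the first
    column of the inverse becomes proportional to [omega], which is [y s *: c]
    with the entries in [T] erased and entry [s] corrected to keep [omega]
    orthogonal to [ystar].  Every other row except row 0 is corrected by a
    multiple of row 0 so as to be orthogonal to [omega] too; [D] is the product
    of row 0 with [omega]. *)
Let ystar j : P := if S j then 0 else y j.
Let omega j : P := if j == s then - \sum_(k | (k != s) && ~~ T k) ystar k * c k
               else if T j then 0 else y s * c j.
Let D : P := \sum_j Z ord0 j * omega j.
Let Zstar i j : P := if i == ord_max then ystar j else Z i j.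
Let N i j : P := D * Zstar i j
  - (if i == ord0 then 0 else \sum_k Zstar i k * omega k) * Z ord0 j.

Let ystar_congr j : ystar j - y j \in E.
Proof.
rewrite /ystar; case: ifPn => Sj; last by rewrite subrr ideal0.
by rewrite sub0r rpredN mem_cuty.
Qed.

Let Zstar_congr i j : Zstar i j - Z i j \in E.
Proof. by rewrite /Zstar; case: eqP => [->|_] //; rewrite subrr ideal0. Qed.

Let omega_congr j : omega j - y s * c j \in E.
Proof.
rewrite /omega; case: (eqVneq j s) => [->|js]; last first.
  case: ifPn => Tj; last by rewrite subrr ideal0.
  by rewrite sub0r rpredN idealM // mem_cutc.
have ys : y s * c s = - \sum_(k | k != s) y k * c k.
  apply/eqP; rewrite -addr_eq0; have := row_cofactor Z ord_max ord0.
  by rewrite mulr0n (bigD1 s) //= => ->.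
rewrite ys opprK addrC (bigID T) /= -addrA; apply: (@idealD _ E).
  by apply: rpred_sum => k /andP[_ Tk]; rewrite idealM // mem_cutc.
rewrite -sumrB; apply: rpred_sum => k _.
by rewrite -mulrBl mulrC idealM // -opprB rpredN.
Qed.

Let Zstar_omega_congr i : \sum_k Zstar i k * omega k - (y s * d) *+ (i == ord0) \in E.
Proof.
rewrite -mulrnAr -row_cofactor mulr_sumr -sumrB; apply: rpred_sum => k _.
have -> : Zstar i k * omega k - y s * (Z i k * c k) =
  omega k * (Zstar i k - Z i k) + Z i k * (omega k - y s * c k) by ring.
by rewrite idealD ?idealM.
Qed.

Let D_congr : D - y s * d \in E.
Proof. exact: Zstar_omega_congr ord0. Qed.

Let N_congr i j : N i j - D * Z i j \in E.
Proof.
rewrite /N addrAC -mulrBr rpredB //; first exact: idealM.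
rewrite mulrC idealM //.
case: eqVneq => [_|i0]; first exact: ideal0.
by have := Zstar_omega_congr i; rewrite (negPf i0) subr0.
Qed.

Let ystar_omega : \sum_j ystar j * omega j = 0.
Proof.
rewrite (bigD1 s) //= {1}/ystar (negPf Ss) {1}/omega eqxx mulrN mulr_sumr.
apply/eqP; rewrite addrC subr_eq0; apply/eqP.
rewrite (bigID T) /= big1 ?add0r => [|k /andP[ks Tk]]; last first.
  by rewrite /omega (negPf ks) Tk mulr0.
by apply: eq_bigr => k /andP[ks Tk]; rewrite /omega (negPf ks) (negPf Tk) mulrCA.
Qed.

Let N_omega i : \sum_j N i j * omega j = (D * D) *+ (i == ord0).
Proof.
under eq_bigr => j _ do rewrite /N mulrBl -!mulrA.
rewrite sumrB -!mulr_sumr -/D.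
case: eqVneq => [->|i0]; first by rewrite mul0r subr0.
by rewrite mulrC subrr.
Qed.

Let satE := saturation (y s * d) E.
Let theta : {rmorphism P -> {fraction P}} := frac_eval D N.

Let D_sat f e : D ^+ e * f \in E -> f \in satE.
Proof.
move=> De; apply/mem_saturation; exists e.
have /(idealM f) : (y s * d) ^+ e - D ^+ e \in E.
  rewrite -[e]card_ord -!prodr_const; apply: prod_congr => _.
  by rewrite -opprB rpredN.
rewrite mulrBr ![f * _]mulrC => DE.
by rewrite -[X in X \in _](subrK (D ^+ e * f)); apply: (@idealD _ E).
Qed.

(** Where [y s * d] is invertible, the ideal [E] is the kernel of the
    substitution of [N / D]: this matrix satisfies the equations, and it is
    congruent to [Z] modulo [E].  If [D] or the image of [d] is zero, the locus
    does not meet the chart.  The function [c s] does not vanish on the locus as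
    soon as its expression in the other coordinates keeps one term, of index
    [a]. *)
Lemma chart_prime : 1 \in satE \/
  [/\ prime_or_unit satE, forall j, ~~ S j -> y j \notin satE
    & forall a, a != s -> ~~ S a -> ~~ T a -> c s \notin satE].
Proof.
have [D0|D_neq0] := eqVneq D 0.
  by left; apply: (@D_sat _ 1%N); rewrite D0 mul0r ideal0.
(* If [theta d = 0], then [d] itself lies locally in [E]. *)
have [d0|d_neq0] := eqVneq (theta d) 0.
  left; have [e De] := frac_eval_ker D_neq0 N_congr d0.
  have /mem_saturation[k dk] := D_sat De.
  apply/mem_saturation; exists k.+1.
  by rewrite mulr1 exprSr mulrCA idealM.
right.
have yE j : theta (y j) = (ystar j)%:F.
  have -> : theta (y j) = frac_mx D N ord_max j := mxevalX _ _ _ _.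
  rewrite mxE /N /Zstar eqxx.
  rewrite ystar_omega (_ : (ord_max == ord0 :> 'I_n) = false) //.
  by rewrite mul0r subr0 tofracM mulrC mulKf ?tofrac_eq0.
have cE j : D%:F * theta (c j) = theta d * (omega j)%:F.
  have -> : theta d = \det (frac_mx D N) := mxeval_det _ _.
  have -> : theta (c j) = cofactor (frac_mx D N) ord0 j := mxeval_cofactor _ _ _ _.
  apply: (cofactor_solution (w := fun k => (omega k)%:F)) => i.
  have -> : \sum_j0 frac_mx D N i j0 * (omega j0)%:F =
      (\sum_j0 N i j0 * omega j0)%:F / D%:F.
    rewrite rmorph_sum mulr_suml; apply: eq_bigr => k _ /=.
    by rewrite mxE tofracM mulrAC.
  rewrite N_omega; case: (i == ord0); rewrite ?mulr1n ?mulr0n ?tofrac0 ?mul0r //.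
  by rewrite tofracM mulfK ?tofrac_eq0.
have ker f : (f \in satE) = (theta f == 0).
  apply/idP/eqP => [|/(frac_eval_ker D_neq0 N_congr)[e /D_sat] //].
  case/mem_saturation=> k fE.
  have ker0 g : g \in E -> theta g = 0.
    move=> /asboolP[t tE ->]; rewrite rmorph_sum big_seq big1 // => z /tE.
    case=> [[j Sj zE]|[b Tb zE]]; rewrite rmorphM /= zE.
      by rewrite yE /ystar Sj tofrac0 mulr0.
    have /eqP : D%:F * theta (c b) = 0.
      by rewrite cE /omega Tb; case: eqP Tb Ts => [->->|] //; rewrite tofrac0 mulr0.
    by rewrite mulf_eq0 tofrac_eq0 (negPf D_neq0) => /eqP ->; rewrite mulr0.
  have /eqP := ker0 _ fE; rewrite !rmorphM rmorphXn !rmorphM /= yE.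
  rewrite mulf_eq0 expf_eq0 mulf_eq0 (negPf d_neq0) /ystar (negPf Ss) tofrac_eq0.
  have ys : y s != 0 by apply: genericmx_neq0.
  by rewrite (negPf ys) andbF => /eqP.
split.
- move=> f g; rewrite !ker rmorphM mulf_eq0 => /orP[]; [left|right]; assumption.
- move=> j Sj; rewrite ker yE /ystar (negPf Sj) tofrac_eq0.
  exact: genericmx_neq0.
- move=> a as_ Sa Ta; rewrite ker.
  suff: theta d * (omega s)%:F != 0 by rewrite -cE mulf_eq0 negb_or => /andP[].
  apply: mulf_neq0; first exact: d_neq0.
  rewrite tofrac_eq0 /omega eqxx oppr_eq0.
  rewrite (bigID S) /= big1 ?add0r => [|k /andP[_ Sk]]; last first.
    by rewrite /ystar Sk mul0r.
  rewrite (eq_bigr (fun k => y k * c k)) => [|k /andP[_ Sk]]; last first.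
    by rewrite /ystar (negPf Sk).
  apply: (@partial_trace_neq0 _ s a) => //; rewrite ?eqxx //.
  by rewrite as_ Ta Sa.
Qed.
End Chart.

(** * Primality of the components *)

Lemma det_last_row : d = \sum_s y s * cofactor Z ord_max s.
Proof. exact: expand_det_row. Qed.

(** For [k = h i] these define the candidates for the irreducible components. *)
Definition component_ideal (i k : 'I_n) : ideal P :=
  cut_ideal [pred j : 'I_n | (j < i)%N] [pred b : 'I_n | (k < b)%N].

(** Let [J'] omit the generator [c s] of [J].  From [y k * f = r * c s] modulo
    [J'] and [c s] nonzero modulo the prime [J' + (y k)], one gets that [y k]
    divides [r] modulo [J'], and then cancels [y k] modulo the prime [J'].  The
    condition [i < k] provides a term [y i * c i] of [c s] that survives
    modulo [y k]. *)
Lemma component_nzd_quadric (i k s : 'I_n) (J := component_ideal i k) f :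
  (i < k < s)%N -> y k * f \in saturation (y s * d) J ->
  f \in saturation (y s * d) J.
Proof.
case/andP=> ik ks; set e := y s * d => ykf.
pose S : pred 'I_n := [pred j : 'I_n | (j < i)%N].
pose Sk : pred 'I_n := [pred j : 'I_n | (j < i)%N || (j == k)].
pose T : pred 'I_n := [pred b : 'I_n | (k < b)%N && (b != s)].
have sS : ~~ S s by rewrite /S /= -leqNgt (ltnW (ltn_trans ik ks)).
have sSk : ~~ Sk s.
  by rewrite /Sk /= negb_or sS /= neq_ltn ks orbT.
have sT : ~~ T s by rewrite /T /= eqxx andbF.
have kS : ~~ S k by rewrite /S /= -leqNgt ltnW.
have iSk : ~~ Sk i by rewrite /Sk /= ltnn neq_ltn ik.
have iT : ~~ T i by rewrite /T /= ltnNge (ltnW ik).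
have si : i != s by rewrite neq_ltn (ltn_trans ik ks).
have subJ : {subset cut_ideal S T <= J}.
  by apply: cut_idealS => // b /andP[].
have satJ : {subset saturation e (cut_ideal S T) <= saturation e J}.
  by apply: saturationS => g /subJ /sub_saturation; apply.
have subSk : {subset cut_ideal S T <= cut_ideal Sk T}.
  by apply: cut_idealS => // j Sj; apply/orP; left.
case: (chart_prime sS sT) => [/(ideal1 f)/satJ // | [primeS yS _]].
have /mem_saturation[l fJ] := ykf.
have [r hr] : exists r, e ^+ l * (y k * f) - r * c s \in cut_ideal S T.
  apply: ideal_gen_adjoin fJ => g [[j ji ->]|[b kb ->]].
    by left; left; exists j.
  have [->|bs] := eqVneq b s; first by right.
  by left; right; exists b => //; apply/andP.
have : r * c s \in cut_ideal Sk T.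
  rewrite -[r * c s](subKr (e ^+ l * (y k * f))) rpredB //; last exact: subSk.
  by rewrite mulrCA mulrC; apply/idealM/mem_cuty/orP; right.
move=> rc; have : r \in saturation e (cut_ideal Sk T).
  case: (chart_prime sSk sT) => [/ideal1 // | [primeSk _ cSk]].
  have /primeSk[//|cs] := sub_saturation e rc.
  by have := cSk _ si iSk iT; rewrite cs.
case/mem_saturation=> l' rSk.
have [r' hr'] : exists r', e ^+ l' * r - r' * y k \in cut_ideal S T.
  apply: ideal_gen_adjoin rSk => g [[j /orP[ji|/eqP ->] ->]|[b Tb ->]].
  - by left; left; exists j.
  - by right.
  - by left; right; exists b.
have : y k * (e ^+ (l' + l) * f - r' * c s) \in cut_ideal S T.
  have -> : y k * (e ^+ (l' + l) * f - r' * c s) =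
      e ^+ l' * (e ^+ l * (y k * f) - r * c s) + c s * (e ^+ l' * r - r' * y k).
    by rewrite exprD; ring.
  by apply: idealD; apply: idealM.
move=> /(sub_saturation e)/primeS[|/satJ h].
  by move=> yk; have := yS _ kS; rewrite yk.
apply: (@saturation_mull _ _ _ _ (l' + l)).
rewrite -[X in X \in _](subrK (r' * c s)); apply: idealD => //.
apply: sub_saturation; apply: idealM; apply: mem_cutc; exact: ks.
Qed.

(** Three kinds of charts: for [s < i] the locus is empty, for [i <= s <= k] the
    ideal is prime by [chart_prime], and for [k < s] it is cut out by a
    quadric. *)
Lemma component_nzd (i k s : 'I_n) (J := component_ideal i k) f :
    (i <= k)%N -> (i < k)%N || (k == ord_max) ->
  y k * f \in saturation d J -> f \in saturation (y s * d) J.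
Proof.
move=> ik ikmax /(saturation_mulr (y s)) ykf.
have [si|is_] := ltnP s i.
  apply: (@saturation_mull _ _ _ _ 1); apply: sub_saturation.
  by rewrite expr1 -mulrA mulrC idealM // mem_cuty.
have [ks|sk] := ltnP k s.
  apply: component_nzd_quadric ykf; rewrite ks andbT.
  case/orP: ikmax => // /eqP kmax.
  by move: ks; rewrite kmax ltnNge leq_ord.
have sS : ~~ [pred j : 'I_n | (j < i)%N] s by rewrite /= -leqNgt.
have sT : ~~ [pred b : 'I_n | (k < b)%N] s by rewrite /= -leqNgt.
case: (chart_prime sS sT) => [/ideal1 // | [prime yS _]].
case/prime: ykf => // yk; have kS : ~~ [pred j : 'I_n | (j < i)%N] k by rewrite /= -leqNgt.
by have := yS k kS; rewrite yk.
Qed.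

(** As [y k] is a nonzerodivisor, inverting it loses nothing, and the chart
    [s = k] is one of those where [chart_prime] applies. *)
Lemma component_prime (i k : 'I_n) (J := component_ideal i k) :
    (i <= k)%N -> (i < k)%N || (k == ord_max) ->
  1 \in saturation d J \/ (prime_or_unit (saturation d J) /\ y i \notin saturation d J).
Proof.
move=> ik ikmax.
have nzd f : y k * f \in saturation d J -> f \in saturation d J.
  move=> ykf; rewrite det_last_row; apply: saturation_cover => s.
  by rewrite -det_last_row; apply: component_nzd ykf.
have satS f : f \in saturation (y k * d) J -> f \in saturation d J.
  case/mem_saturation=> e; rewrite exprMn -mulrA => /(sub_saturation d) fJ.
  apply: (@saturation_mull _ _ _ _ e).
  move: (d ^+ e * f) fJ => g; elim: e => [|e IHe]; first by rewrite expr0 mul1r.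
  by rewrite exprS -mulrA => /nzd/IHe.
have iS : ~~ [pred j : 'I_n | (j < i)%N] i by rewrite /= ltnn.
have kS : ~~ [pred j : 'I_n | (j < i)%N] k by rewrite /= -leqNgt.
have kT : ~~ [pred b : 'I_n | (k < b)%N] k by rewrite /= ltnn.
case: (chart_prime kS kT) => [/satS one|[prime yS _]]; [left; exact: one | right].
split=> [f g /(saturation_mulr (y k))/prime[/satS fJ|/satS gJ]|].
- by left.
- by right.
by apply: contra (yS i iS); apply: saturation_mulr.
Qed.

(** * Indecomposable Hessenberg functions *)

Section Sufficiency.
Variable h : 'I_n -> 'I_n.
Hypotheses (h_hess : is_hessenberg h) (h_indec : indecomposable h).
Local Notation I := (hessenberg_ideal (min_nilpotent K n) h).

Definition filtration (i : nat) : ideal P :=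
  ideal_gen (fun f => f \in I \/ (exists2 j : 'I_n, (j < i)%N & f = y j)).

Lemma filtrationS (i k : nat) : (i <= k)%N -> {subset filtration i <= filtration k}.
Proof.
move=> ik; apply: ideal_gen_sub => f [fI|[j ji ->]]; apply: mem_ideal_gen; first by left.
by right; exists j => //; apply: leq_trans ik.
Qed.

Lemma filtration_sub_component (i : 'I_n) :
  {subset filtration i <= saturation d (component_ideal i (h i))}.
Proof.
apply: ideal_gen_sub => f [|[j ji ->]]; last first.
  by apply: sub_saturation; apply: mem_cuty.
apply: hessenberg_sub f; first exact: hessenberg_homo.
move=> a b hab; have [ai|ia] := ltnP a i.
  by rewrite mulrC; apply/idealM/mem_cuty.
apply/idealM/mem_cutc; exact: leq_ltn_trans (hessenberg_homo h_hess ia) hab.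
Qed.

Lemma component_mul_filtration (i : 'I_n) f :
  f \in component_ideal i (h i) -> f * y i \in filtration i.
Proof.
rewrite -mem_colon; apply: ideal_gen_sub f => f fG; rewrite mem_colon.
case: fG => [[j ji ->]|[b hib ->]].
  by rewrite mulrC; apply/idealM/mem_ideal_gen; right; exists j.
by rewrite mulrC; apply/mem_ideal_gen; left; apply: mem_hessenberg.
Qed.

(** If [r * y i] lies in the prime [J] and [y i] does not, then so does [r], and
    [r * y i] is already in [filtration i]. *)
Lemma filtration_radical_step (i : 'I_n) :
  (forall f k, f ^+ k \in saturation d (filtration i.+1) ->
    f \in saturation d (filtration i.+1)) ->
  forall f k, f ^+ k \in saturation d (filtration i) ->
    f \in saturation d (filtration i).
Proof.
move=> IH f k fk; pose J := component_ideal i (h i).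
have [_ h_ge] := h_hess.
have hi_ok : (i < h i)%N || (h i == ord_max).
  have [/h_indec -> //|i_last] := ltnP i.+1 n.
  apply/orP; right; rewrite -val_eqE eqn_leq leq_ord /=.
  by rewrite -ltnS; apply: leq_trans i_last _; apply: h_ge.
have FJ := saturationS (filtration_sub_component (i := i)).
have fJ : f \in saturation d J.
  case: (component_prime (h_ge i) hi_ok) => [/ideal1 // | [Jprime _]].
  exact: prime_or_unitX Jprime (FJ _ fk).
have /mem_saturation[e fe] : f \in saturation d (filtration i.+1).
  apply: (IH f k); apply: saturationS fk => g gF.
  by apply: sub_saturation; apply: filtrationS gF.
have [r hr] : exists r, d ^+ e * f - r * y i \in filtration i.
  apply: ideal_gen_adjoin fe => g [gI|[j ji ->]]; first by left; left.
  move: ji; rewrite ltnS leq_eqVlt => /orP[/eqP/val_inj -> | ji]; first by right.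
  by left; right; exists j.
have /mem_saturation[l rJ] : r \in saturation d J.
  case: (component_prime (h_ge i) hi_ok) => [/ideal1 // | [Jprime yJ]].
  have /Jprime[//|yi] : r * y i \in saturation d J.
    rewrite -[r * y i](subKr (d ^+ e * f)); apply: rpredB; first exact: idealM.
    exact: filtration_sub_component hr.
  by move: yJ; rewrite yi.
apply/mem_saturation; exists (l + e)%N.
have -> : d ^+ (l + e) * f = d ^+ l * (d ^+ e * f - r * y i) + (d ^+ l * r) * y i.
  by rewrite exprD; ring.
by apply: idealD; [apply: idealM | apply: component_mul_filtration].
Qed.

Lemma hessenberg_radical f k :
  f ^+ k \in saturation d I -> f \in saturation d I.
Proof.
have radF : forall i, (i <= n)%N -> forall f k, f ^+ k \in saturation d (filtration (n - i)) ->
    f \in saturation d (filtration (n - i)).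
  elim=> [|i IHi] i_le g l.
    move=> _; apply: ideal1; apply/mem_saturation; exists 1%N.
    rewrite expr1 mulr1 subn0 det_last_row; apply: rpred_sum => s _.
    by rewrite mulrC; apply/idealM/mem_ideal_gen; right; exists s.
  have n_i : (n - i.+1 < n)%N by rewrite ltn_subrL.
  apply: (@filtration_radical_step (Ordinal n_i)) => /=.
  by rewrite -subSn // subSS; apply: IHi; apply: ltnW.
have := radF n (leqnn n) f k; rewrite subnn.
have F0 : {subset filtration 0 <= saturation d I}.
  by apply: ideal_gen_sub => g [/sub_saturation|[]].
have I0 : {subset I <= saturation d (filtration 0)}.
  by move=> g gI; apply/sub_saturation/mem_ideal_gen; left.
by move=> rad0 /(saturationS I0)/rad0/(saturationS F0).
Qed.
End Sufficiency.

(** * A nilpotent for decomposable Hessenberg functions *)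

Section Necessity.
Variables (h : 'I_n -> 'I_n) (a : 'I_n).
Hypotheses (h_hess : is_hessenberg h) (ha : h a = a) (a_last : (a.+1 < n)%N).
Local Notation I := (hessenberg_ideal (min_nilpotent K n) h).

(** Up to the factor [d], the trace of the rank one matrix with entries
    [c i * y j / d], restricted to the indices at most [a]. *)
Definition partial_trace : P := \sum_(j < n | (j <= a)%N) y j * c j.

(** Since the full trace vanishes, the square is minus the product of the two
    complementary partial traces, whose terms regroup as
    [(y k * c j) * (y j * c k)] with [j <= a < k]. *)
Lemma partial_trace_sqr : partial_trace ^+ 2 \in I.
Proof.
have pE : partial_trace = - \sum_(j < n | ~~ (j <= a)%N) y j * c j.
  apply/eqP; rewrite -addr_eq0; have := row_cofactor Z ord_max ord0.
  by rewrite mulr0n (bigID (fun j : 'I_n => (j <= a)%N)) /= => ->.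
rewrite expr2 {2}pE mulrN rpredN.
rewrite /partial_trace mulr_suml; apply: rpred_sum => j ja.
rewrite mulr_sumr; apply: rpred_sum => k; rewrite -ltnNge => ak.
rewrite [y k * c k]mulrC mulrACA mulrC.
apply/idealM/mem_hessenberg; apply: leq_ltn_trans ak.
by have := hessenberg_homo h_hess ja; rewrite ha.
Qed.

Let M : 'M[{poly K}]_n := 1%:M + 'X *: delta_mx ord_max ord0.
Let ev : {rmorphism P -> {poly K}} := mxeval polyC M.
Let w (j : 'I_n) : {poly K} := (j == ord0)%:R - 'X * (j == ord_max)%:R.

Let ME i j : M i j = (i == j)%:R + 'X * ((i == ord_max) && (j == ord0))%:R.
Proof. by rewrite !mxE. Qed.

Let detM : \det M = 1.
Proof.
rewrite det_trig.
  apply: big1 => i _; rewrite ME eqxx; case: (eqVneq i ord0) => [->|_];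
  by rewrite ?andbF /= mulr0 addr0.
apply/is_trig_mxP => i j ij; rewrite ME -!val_eqE /= (ltn_eqF ij).
by rewrite (ltn_eqF (leq_trans ij (leq_ord j))) mulr0 addr0.
Qed.

Let ev_c j : ev (c j) = w j.
Proof.
have -> : ev (c j) = cofactor M ord0 j := mxeval_cofactor _ _ _ _.
rewrite -[LHS]mul1r -[RHS]mul1r -[in RHS]detM; apply: cofactor_solution => i.
have sumE (f : 'I_n -> {poly K}) b : \sum_k f k * (k == b)%:R = f b.
  rewrite (bigD1 b) //= eqxx mulr1 big1 ?addr0 // => k /negPf ->.
  by rewrite mulr0.
rewrite (eq_bigr (fun k => M i k * (k == ord0)%:R - 'X * (M i k * (k == ord_max)%:R))).
  rewrite sumrB -mulr_sumr !sumE !ME eqxx andbT /= andbF mulr0 addr0 addrK.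
  by [].
by move=> k _; rewrite mulrBr mulrCA.
Qed.

Let ev_y j : ev (y j) = (j == ord_max)%:R + 'X * (j == ord0)%:R.
Proof.
have -> : ev (y j) = M ord_max j := mxevalX _ _ _ _.
by rewrite ME eqxx [ord_max == j]eq_sym.
Qed.

(** Polynomials that vanish to order two at [X = 0] along the curve [M]. *)
Let X2_pred : {pred P} := fun f => 'X^2 %| ev f.

Let X2_axiom : [/\ 0 \in X2_pred,
  forall x z, x \in X2_pred -> z \in X2_pred -> x + z \in X2_pred
  & forall b x, x \in X2_pred -> b * x \in X2_pred].
Proof.
split=> [|x z|b x]; rewrite /in_mem /= /X2_pred ?rmorph0 ?dvdp0 //.
  by rewrite rmorphD; apply: dvdp_add.
by rewrite rmorphM; apply: dvdp_mull.
Qed.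

(** Along [M] the only nonzero [y j] are [y_0 = 'X] and the last one, 1, and the
    only nonzero [c j] are [c_0 = 1] and the last one, [- 'X].  The only
    nonzero product [y i * c j] with [i < j] is therefore [- 'X^2]. *)
Lemma partial_trace_notin : partial_trace \notin saturation d I.
Proof.
pose J : ideal P := Ideal X2_axiom.
have memJ f : (f \in J) = ('X^2 %| ev f) by [].
have IJ : {subset I <= saturation d J}.
  apply: hessenberg_sub; first exact: hessenberg_homo.
  move=> i j hij; rewrite memJ rmorphM /= ev_y ev_c /w.
  have [_ h_ge] := h_hess.
  have ij : (i < j)%N := leq_ltn_trans (h_ge i) hij.
  have -> : (j == ord0) = false by rewrite -val_eqE /= gtn_eqF // (leq_ltn_trans _ ij).
  have -> : (i == ord_max) = false.
    by rewrite -val_eqE /= (ltn_eqF (leq_trans ij (leq_ord j))).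
  by rewrite add0r sub0r mulrN dvdpNr mulrACA; apply: dvdp_mulr.
apply/negP => /(saturationS IJ)/mem_saturation[k]; rewrite memJ rmorphM rmorphXn /=.
have -> : ev d = 1 by rewrite -detM; apply: mxeval_det.
rewrite expr1n mul1r rmorph_sum (bigD1 ord0) //= big1 ?addr0 => [|j /andP[ja j0]].
  rewrite rmorphM /= ev_y ev_c /w !eqxx.
  rewrite (_ : (ord0 == ord_max :> 'I_n) = false) // add0r mulr1 mulr0 subr0 mulr1.
  by move/dvdp_leq; rewrite polyX_eq0 size_polyXn size_polyX => /(_ isT).
rewrite rmorphM /= ev_y (negPf j0) mulr0 addr0.
have -> : (j == ord_max) = false by rewrite -val_eqE /= ltn_eqF // (leq_ltn_trans ja).
by rewrite mul0r.
Qed.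
End Necessity.
End MinimalNilpotent.

(** * Reducedness and indecomposability *)

Theorem theorem3 (R : realType) (n : nat) (n_ge2 : (2 <= n)%N)
    (h : 'I_n -> 'I_n) (h_hess : is_hessenberg h) :
  reduced_Spec (matrix_hessenberg_ring (min_nilpotent R[i] n) h) <->
  indecomposable h.
Proof.
case: n n_ge2 h h_hess => [//|[//|m]] _ h h_hess.
rewrite reduced_SpecP reduced_quotientP; split=> [red i i_last|indec f k].
  rewrite ltn_neqAle (proj2 h_hess) andbT; apply/eqP => /esym/val_inj hi.
  have /negP := partial_trace_notin R[i] h_hess i_last; apply.
  apply: (red _ 2%N); apply: sub_saturation; exact: partial_trace_sqr.
exact: hessenberg_radical.
Qed.
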